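(* Let $n$ be a positive integer and $S\subseteq[n-1]$. The descent set statistic $\beta_n(S)$ modulo $2$ is given by the reduced Euler characteristic of the induced subcomplex $\Delta_n|_S$, that is, $$\beta_n(S)\equiv\widetilde{\chi}(\Delta_n|_S) \bmod 2.$$
   Context: $[n-1]=\{1,\dots,n-1\}$. For $S\subseteq[n-1]$, $\beta_n(S)$ is the number of permutations $\pi\in\mathfrak{S}_n$ with descent set $\{i\in[n-1] : \pi_i>\pi_{i+1}\}$ equal to $S$. For $S=\{s_1<\cdots<s_k\}\subseteq[n-1]$, the associated composition of $n$ is $\mathrm{co}(S)=(c_1,\dots,c_{k+1})$ with $c_i=s_i-s_{i-1}$, $s_0=0$, $s_{k+1}=n$. $\Delta_n$ is the simplicial complex whose faces are the sets $F\subseteq[n-1]$ such that, with $\mathrm{co}(F)=(c_1,\dots,c_{k+1})$, the addition $c_1+\cdots+c_{k+1}=n$ has no carries in base $2$ (equivalently, the binary expansions of the $c_i$ have pairwise disjoint supports); the empty set is a face, and not every element of $[n-1]$ need be a vertex. $\Delta_n|_S=\{F\subseteq S : F\in\Delta_n\}$. The reduced Euler characteristic is $\widetilde{\chi}(\Delta)=\sum_{F\in\Delta}(-1)^{|F|-1}$, including the empty face. *)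

(* Defs.v *)
From HB Require Import structures.
From mathcomp Require Import all_boot all_order all_algebra all_fingroup.

Set Implicit Arguments.
Unset Strict Implicit.
Unset Printing Implicit Defensive.

Import GRing.Theory.

(* The interval [n-1] = {1, ..., n-1} is embedded in 'I_n = {0, ..., n-1}, so   *)
(* that a descent position i is literally the ordinal of value i.              *)
Definition positions (n : nat) : {set 'I_n} := [set i : 'I_n | 0 < i].

(* Permutations act on {0, ..., n-1}: the one-line entry pi_(k+1) is the image *)
(* of k. Thus pi_i > pi_(i+1) compares the images of j = i - 1 and of i.       *)
Definition descent_set (n : nat) (pi : 'S_n) : {set 'I_n} :=
  [set i in positions n | [exists j : 'I_n, (j.+1 == i) && (pi j > pi i)]].

Definition beta (n : nat) (S : {set 'I_n}) : nat :=
  #|[set pi : 'S_n | descent_set pi == S]|.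

(* [enum S] lists the elements of S in increasing order.                       *)
Definition co (n : nat) (S : {set 'I_n}) : seq nat :=
  pairmap (fun a b => b - a) 0 (rcons [seq val i | i <- enum S] n).

Definition bit (c j : nat) : bool := odd (c %/ 2 ^ j).

(* The carry entering column j in the base 2 addition of the entries of cs.    *)
Fixpoint carry (cs : seq nat) (j : nat) : nat :=
  if j is j'.+1 then (\sum_(c <- cs) bit c j' + carry cs j') %/ 2 else 0.

(* Columns beyond the sum of cs contain only zeros; see [no_carryP].           *)
Definition no_carry (cs : seq nat) : bool :=
  [forall j : 'I_(sumn cs).+1, carry cs j == 0].

Lemma bit_small (c j : nat) : c <= j -> bit c j = false.
Proof.
move=> le_cj; rewrite /bit divn_small //.
exact: leq_ltn_trans le_cj (ltn_expl j (leqnn 2)).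
Qed.

Lemma no_carryP (cs : seq nat) :
  reflect (forall j, carry cs j = 0) (no_carry cs).
Proof.
apply: (iffP forallP) => [nc j | nc j]; last by rewrite nc.
elim: j => [//|j IHj].
have [lt_j|le_j] := ltnP j (sumn cs).
  by apply/eqP; apply: (nc (Ordinal (_ : j.+1 < (sumn cs).+1))).
rewrite /= IHj addn0 big_seq big1 // => c c_cs.
rewrite bit_small // (leq_trans _ le_j) //.
by rewrite sumnE (perm_big _ (perm_to_rem c_cs)) big_cons leq_addr.
Qed.

Lemma no_carry_disjointP (cs : seq nat) :
  reflect (forall j, \sum_(c <- cs) bit c j <= 1) (no_carry cs).
Proof.
apply: (iffP (no_carryP cs)) => nc j.
  by have /eqP := nc j.+1; rewrite /= nc addn0 -leqn0 leqNgt divn_gt0 // -leqNgt.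
elim: j => [//|j IHj] /=; rewrite IHj addn0 divn_small //.
by rewrite ltnS.
Qed.

Definition Delta (n : nat) : {set {set 'I_n}} :=
  [set F : {set 'I_n} | (F \subset positions n) && no_carry (co F)].

Definition induced (n : nat) (K : {set {set 'I_n}}) (S : {set 'I_n}) :
  {set {set 'I_n}} := [set F in K | F \subset S].

(* The exponent is an integer: the empty face contributes (-1) ^ (-1) = -1.    *)
Definition reduced_euler (n : nat) (K : {set {set 'I_n}}) : int :=
  (\sum_(F in K) (-1) ^ (#|F|%:Z - 1))%R.

(* Main.v *)
(* Let alpha(T) be the number of permutations whose descent set is contained in
   T. An interval of a Boolean lattice has odd size only if it is a point, so
   beta(S) is congruent to the sum of alpha(T) over T inside S. The cosets of
   the Young subgroup of co(T) show that alpha(T) is the multinomial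
   coefficient n! / prod c_i!, and by Legendre's formula its 2-adic valuation is
   the sum of all the carries in the base 2 addition of the c_i (Kummer).
   Hence alpha(T) is odd exactly when T is a face of Delta_n, and signs do not
   matter modulo 2. *)
Require Import Defs.
From mathcomp Require Import all_boot all_order all_algebra all_fingroup.
From mathcomp Require Import zify.

Set Implicit Arguments.
Unset Strict Implicit.
Unset Printing Implicit Defensive.

Import GRing.Theory.

(** * Order of a Young subgroup *)

(** The support condition lets the induction add one colour class at a time: each permutation
    counted for [k :: r] factors uniquely into one moving only the class of [k] and one counted for
    [r]. *)
Lemma card_color_perms (T : finType) (f : T -> nat) (r : seq nat) :
  uniq r ->
  #|[set s : {perm T} | perm_on [set x | f x \in r] s
                        & [forall x, f (s x) == f x]]|
  = \prod_(k <- r) #|[set x | f x == k]|`!.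
Proof.
elim: r => [_|k r IHr /= /andP[kNr uniq_r]].
  rewrite big_nil; apply/eqP/cards1P; exists 1%g; apply/setP => s.
  rewrite !inE; apply/andP/eqP => [[s_on _]|->].
    apply: (perm_on_id s_on).
    by rewrite (_ : [set _ | _] = set0) ?cards0 //; apply/setP => x; rewrite !inE.
  by split; [exact: perm_on1 | apply/forallP => x; rewrite perm1].
rewrite big_cons -IHr // -card_perm.
set A := [set x | f x == k]; set Y := [set s | _ & _]; set Z := [set s | _ & _].
have ZA s x : s \in Z -> x \in A -> s x = x.
  rewrite !inE => /andP[s_on _] /eqP fx.
  by apply: (out_perm s_on); rewrite inE fx.
have AsubA s x : perm_on A s -> f (s x) = f x.
  move=> s_on; have [xA|xNA] := boolP (x \in A); last by rewrite (out_perm s_on).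
  have := xA; rewrite -(perm_closed x s_on) inE => /eqP->.
  by move: xA; rewrite inE => /eqP->.
have -> : #|perm_on A| = #|[set s | perm_on A s]| by rewrite cardsE.
rewrite -cardsX.
have <- : [set (p.1 * p.2)%g | p in setX [set s | perm_on A s] Z] = Y.
  apply/setP => u; apply/imsetP/idP => [[[s t] /=]|].
    rewrite !inE /= => /and3P[s_on t_on /forallP tf] ->; apply/andP; split.
      apply: perm_onM; [apply: subset_trans s_on _|apply: subset_trans t_on _].
        by apply/subsetP => x; rewrite !inE => ->.
      by apply/subsetP => x; rewrite !inE orbC => ->.
    by apply/forallP => x; rewrite permM (eqP (tf _)) AsubA.
  rewrite !inE => /andP[u_on /forallP uf].
  (* Preserving colours, [u] maps the class [A] to itself. Its restriction to [A], extended by the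
     identity, is the first factor [s], and [s^-1 * u] then fixes [A] pointwise. *)
  have uN : u \in 'N(A | 'P)%g.
    by apply/astabsP => x; rewrite /= apermE !inE (eqP (uf x)).
  have sE := restr_permE uN.
  have s_on := restr_perm_on A u; set s := restr_perm A u in sE s_on.
  exists (s, (s^-1 * u)%g); last by rewrite /= mulKVg.
  have sV_on := perm_onV s_on.
  rewrite !inE /= s_on /=; apply/andP; split; last first.
    by apply/forallP => x; rewrite permM (eqP (uf _)) AsubA.
  apply/subsetP => x; rewrite !inE permM; apply: contraNT => xNr.
  have [xA|xNA] := boolP (x \in A).
    by rewrite -sE ?permKV // perm_closed.
  rewrite (out_perm sV_on) // (out_perm u_on) //.
  by rewrite !inE (negPf xNr) orbF; rewrite inE in xNA.
rewrite card_in_imset // => -[s t] [s' t'] /=.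
case/setXP; rewrite inE => s_on tZ /setXP[].
rewrite inE => s'_on t'Z eq_st.
have eq_s : s = s'.
  apply/permP => x; have [xA|xNA] := boolP (x \in A); last first.
    by rewrite (out_perm s_on) // (out_perm s'_on).
  by have /permP/(_ x) := eq_st; rewrite !permM (ZA t) ?(ZA t') ?perm_closed.
by move: eq_st; rewrite eq_s => /mulgI->.
Qed.

(** * Blocks of positions and the composition *)

(** This is the index, from 0, of the part of [co T] whose interval contains position [i]: each
    element of [T] opens a new block. If 0 lies in [T], block 0 is empty and the first part is 0. *)
Definition block (n : nat) (T : {set 'I_n}) (i : nat) : nat :=
  #|[set t in T | t <= i]|.

Lemma block_homo (n : nat) (T : {set 'I_n}) :
  {homo block T : i j / i <= j}.
Proof.
move=> i j le_ij; apply/subset_leq_card/subsetP => t; rewrite !inE.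
by case/andP=> -> /leq_trans->.
Qed.

Lemma block_max (n : nat) (T : {set 'I_n}) (i : nat) : block T i <= #|T|.
Proof. by apply/subset_leq_card/subsetP => t; rewrite !inE => /andP[]. Qed.

(** In an increasing list the entries at most [i] form a prefix. *)
Lemma ltn_count_sorted (s : seq nat) (k i : nat) :
  sorted ltn s -> k < size s -> (k < count (leq^~ i) s) = (nth 0 s k <= i).
Proof.
elim: s k => //= x s IHs k s_sorted lt_k.
have /allP x_lt := order_path_min ltn_trans s_sorted.
case: (leqP x i) => le_xi.
  by case: k lt_k => [|k] lt_k //=; rewrite add1n ltnS IHs ?(path_sorted s_sorted).
have -> : count (leq^~ i) s = 0.
  apply/eqP; rewrite -leqn0 leqNgt -has_count; apply/hasPn => y /x_lt /= lt_xy.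
  by rewrite -ltnNge (ltn_trans le_xi).
rewrite ltn0; case: k lt_k => [|k] lt_k /=; first by rewrite leqNgt le_xi.
apply/esym/negbTE; rewrite -ltnNge (ltn_trans le_xi) // x_lt //.
by rewrite mem_nth.
Qed.

Lemma sorted_val_enum (n : nat) (T : {set 'I_n}) :
  sorted ltn [seq val i | i <- enum T].
Proof.
rewrite sorted_map /enum_mem (sorted_filter (leT := relpre val ltn)) //.
  by move=> y x z; apply: ltn_trans.
by rewrite -sorted_map -enumT val_enum_ord iota_ltn_sorted.
Qed.

Lemma card_ord_interval (n a b : nat) :
  b <= n -> #|[set i : 'I_n | a <= i < b]| = b - a.
Proof.
move=> le_bn; rewrite -sum1dep_card.
rewrite -(big_mkord (fun i => a <= i < b) (fun=> 1)).
rewrite -[RHS]muln1 -sum_nat_const_nat (big_nat_widen a b n) //.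
by rewrite (big_nat_widenl a 0) //=; apply: eq_bigl => i; rewrite andbC.
Qed.

Lemma size_co (n : nat) (T : {set 'I_n}) : size (co T) = #|T|.+1.
Proof. by rewrite size_pairmap size_rcons size_map -cardE. Qed.

(** A part is the length of an interval between consecutive cuts, and that interval is a level set
    of [block T]. Parts thereby become sizes of colour classes. *)
Lemma co_block (n : nat) (T : {set 'I_n}) :
  co T = [seq #|[set i : 'I_n | block T i == k]| | k <- iota 0 #|T|.+1].
Proof.
apply: (@eq_from_nth _ 0); rewrite size_co ?size_map ?size_iota // => k lt_k.
rewrite (nth_map 0) ?size_iota // nth_iota // add0n.
rewrite (nth_pairmap 0); last by rewrite size_rcons size_map -cardE.
set s := [seq val i | i <- enum T].
have size_s : size s = #|T| by rewrite size_map -cardE.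
have s_sorted : sorted ltn s by apply: sorted_val_enum.
have blockE i : block T i = count (leq^~ i) s.
  by rewrite count_map -sum1_count big_enum_cond sum1dep_card.
have hi_n : nth 0 (rcons s n) k <= n.
  rewrite nth_rcons; case: ltnP => [lt_ks|_]; last by case: ifP.
  by have /mapP[i _ ->] := mem_nth 0 lt_ks; apply: ltnW; apply: ltn_ord.
rewrite -(card_ord_interval _ hi_n); apply: eq_card => i; rewrite !inE.
rewrite eqn_leq [RHS]andbC blockE; congr (_ && _).
  case: k lt_k {hi_n} => [|k] /= lt_k; first by rewrite !leq0n.
  by rewrite nth_rcons size_s (lt_k : k < #|T|) ltn_count_sorted // size_s.
(* The upper end is an element of [T], except for the last block, which ends at the appended [n]. *)
rewrite nth_rcons size_s; case: (ltnP k #|T|) => [lt_kT|le_Tk].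
  by rewrite ltnNge -ltn_count_sorted ?size_s // -leqNgt.
have -> : k = #|T| by apply/eqP; rewrite eqn_leq le_Tk andbT -ltnS.
by rewrite eqxx ltn_ord -size_s count_size.
Qed.

(** * Counting permutations with descents inside a given set *)

Lemma block_succ (n : nat) (T : {set 'I_n}) (i : 'I_n) (j : nat) :
  j.+1 = i -> i \notin T -> block T i = block T j.
Proof.
move=> ji iNT; apply: eq_card => t; rewrite !inE -ji leq_eqVlt ltnS ji.
by case: eqP => //= /val_inj ->; rewrite (negPf iNT).
Qed.

(** Past its first position a block avoids [T], so it contains only ascents between neighbours;
    these chain up by induction on [j]. *)
Lemma descent_sub_block (n : nat) (T : {set 'I_n}) (pi : 'S_n) (i j : 'I_n) :
  descent_set pi \subset T -> i < j -> block T i = block T j -> pi i < pi j.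
Proof.
move=> /subsetP desT; elim: {j}(j : nat) {-2}j (erefl (j : nat)) => [|m IHm] j jm.
  by rewrite jm.
move=> lt_ij eq_ij; have le_im : i <= m by rewrite -ltnS -jm.
have lt_mn : m < n by rewrite ltnW // -jm.
pose m' := Ordinal lt_mn.
have eq_im : block T i = block T m'.
  by apply/eqP; rewrite eqn_leq block_homo //= eq_ij block_homo // jm leqnSn.
have jNT : j \notin T.
  apply/negP => jT; suff : block T m' < block T j by rewrite -eq_im eq_ij ltnn.
  apply/proper_card/properP; split.
    by apply/subsetP => t; rewrite !inE jm => /andP[-> /leqW].
  by exists j; rewrite !inE jT ?jm ?leqnn //= ltnn.
have : pi m' < pi j.
  rewrite ltn_neqAle; apply/andP; split.
    apply/eqP => /val_inj/perm_inj/(congr1 val) /=; rewrite jm; lia.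
  rewrite leqNgt; apply: contra jNT => des; apply: desT.
  rewrite !inE jm /=; apply/existsP; exists m'; by rewrite eqxx.
move: le_im; rewrite leq_eqVlt => /predU1P[im|lt_im].
  by have -> : i = m' by apply: val_inj.
by apply: ltn_trans; apply: IHm.
Qed.

(** An increasing [t] satisfies [i <= t i]; this is applied to [s] and to its inverse. *)
Lemma homo_perm1 (n : nat) (s : 'S_n) :
  {homo s : i j / (i < j)%N} -> s = 1%g.
Proof.
move=> s_homo.
have ge_s (t : 'S_n) : {homo t : i j / (i < j)%N} -> forall i : 'I_n, i <= t i.
  move=> t_homo i; elim: {i}(i : nat) {-2}i (erefl (i : nat)) => [|m IHm] i im.
    by rewrite im.
  have lt_mn : m < n by rewrite ltnW // -im.
  rewrite im; apply: leq_ltn_trans (IHm (Ordinal lt_mn) erefl) _.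
  by apply: t_homo; rewrite /= im.
have sV_homo : {homo s^-1%g : i j / (i < j)%N}.
  move=> i j lt_ij; rewrite ltnNge leq_eqVlt; apply/negP => /predU1P[|lt_s].
    by move/val_inj/perm_inj => ij; rewrite ij ltnn in lt_ij.
  by have := s_homo _ _ lt_s; rewrite !permKV ltnNge ltnW.
apply/permP => i; apply: val_inj; rewrite perm1; apply/eqP.
rewrite eqn_leq ge_s // andbT.
by have := ge_s _ sV_homo (s i); rewrite permK.
Qed.

(* Every coset of the Young subgroup contains exactly one permutation that
   increases on blocks; for existence, maximise \sum_i i * pi i. *)
Lemma card_descent_sub (n : nat) (T : {set 'I_n}) :
  #|[set pi : 'S_n | descent_set pi \subset T]|
    * \prod_(c <- co T) c`! = n`!.
Proof.
rewrite co_block big_map.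
rewrite -(@card_color_perms _ (fun i : 'I_n => block T i)) ?iota_uniq //.
set A := [set pi | descent_set pi \subset T]; set Y := [set s : 'S_n | _ & _].
have YE s : (s \in Y) = [forall x : 'I_n, block T (s x) == block T x].
  rewrite inE; apply: andb_idl => _; apply/subsetP => x _.
  by rewrite inE mem_iota ltnS block_max.
rewrite -cardsX.
have -> : n`! = #|[set s | perm_on [set: 'I_n] s]|.
  by rewrite cardsE card_perm cardsT card_ord.
(* The left factor of a product acts first, so elements of [Y] rearrange positions within blocks. *)
have <- : [set (p.2 * p.1)%g | p in setX A Y] = [set s | perm_on [set: 'I_n] s].
  apply/setP => u; rewrite [RHS]inE.
  have -> : perm_on [set: 'I_n] u by apply/subsetP => x; rewrite inE.
  apply/imsetP.
  have Y1 : 1%g \in Y by rewrite YE; apply/forallP => x; rewrite perm1.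
  pose F (s : 'S_n) := \sum_(i < n) i * u (s i).
  have [s sY s_max] := arg_maxnP F Y1.
  exists ((s * u)%g, (s^-1)%g); last by rewrite /= mulKg.
  have /forallP sB : [forall x : 'I_n, block T (s x) == block T x] by rewrite -YE.
  apply/setXP; split => /=; last first.
    by rewrite YE; apply/forallP => x; rewrite -(eqP (sB _)) permKV.
  rewrite inE; apply/subsetP => i; rewrite !inE => /andP[_ /existsP[j /andP[/eqP ji des]]].
  apply/negPn/negP => iNT.
  have eqB := block_succ ji iNT.
  have ij : i != j by apply/eqP => ij; rewrite ij in ji; lia.
  (* The neighbours [j] and [i] share a block. Swapping them stays in [Y] and, since [s * u]
     descends at [i], raises [F] by [u (s j) - u (s i) > 0], contradicting maximality. *)
  have tY : (tperm i j * s)%g \in Y.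
    rewrite YE; apply/forallP => x; rewrite permM (eqP (sB _)).
    by case: tpermP => [->|->|//]; rewrite eqB.
  have sumE (h : 'I_n -> nat) :
      \sum_k h k = h i + (h j + \sum_(k | (k != i) && (k != j)) h k).
    by rewrite (bigD1 i) //= (bigD1 j) //= eq_sym.
  have := s_max _ tY; rewrite /F /=.
  rewrite !sumE.
  rewrite !permM tpermL tpermR.
  rewrite [X in _ + (_ + X)](eq_bigr (fun k : 'I_n => k * u (s k))); last first.
    by move=> k /andP[ki kj]; rewrite permM tpermD // eq_sym.
  move: des; rewrite !permM -ji !addnA leq_add2r; nia.
rewrite card_in_imset // => -[p s] [p' s'].
case/setXP => /= pA sY /setXP[/= p'A s'Y] eq_sp.
pose t := (s'^-1 * s)%g.
have p'E : p' = (t * p)%g by rewrite -mulgA eq_sp mulKg.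
move: sY s'Y; rewrite !YE => /forallP sB /forallP s'B.
have tB x : block T (t x) = block T x.
  by rewrite permM (eqP (sB _)) -(eqP (s'B _)) permKV.
rewrite !inE in pA p'A.
suff t1 : t = 1%g.
  have ss' : s = s' by rewrite -[s](mulKVg s') -/t t1 mulg1.
  by rewrite p'E t1 mul1g ss'.
(* Between different blocks [t] keeps the order because it preserves blocks; inside a block, [p] and
   [t * p] both increase, which forces [t] to increase. *)
apply: homo_perm1 => i j lt_ij.
have [eqB|] := eqVneq (block T i) (block T j); last first.
  move=> neqB; rewrite ltnNge; apply: contra neqB => le_t.
  by rewrite eqn_leq block_homo ?(ltnW lt_ij) //= -(tB i) -(tB j) block_homo.
have := descent_sub_block p'A lt_ij eqB; rewrite p'E !(permM t) => lt_p.
rewrite ltnNge leq_eqVlt; apply/negP => /predU1P[eq_t|lt_t].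
  by move: lt_p; rewrite (val_inj eq_t) ltnn.
have := descent_sub_block pA lt_t; rewrite !tB eqB => /(_ erefl).
by rewrite ltnNge ltnW.
Qed.

(** * Carries and 2-adic valuations *)

(** Invariant of column addition: halving consumes the bits of column [j] and the incoming carry,
    leaving the next carry. It measures the gap between the Legendre terms of a sum and of its
    summands. *)
Lemma divn_sum_carry (cs : seq nat) (j : nat) :
  sumn cs %/ 2 ^ j = \sum_(c <- cs) c %/ 2 ^ j + carry cs j.
Proof.
elim: j => [|j IHj].
  by rewrite divn1 addn0 sumnE; apply: eq_bigr => c _; rewrite divn1.
rewrite [in LHS]expnSr divnMA IHj /=.
rewrite (eq_bigr (fun c => bit c j + (c %/ 2 ^ j.+1) * 2)); last first.
  move=> c _; rewrite /bit {1}(divn_eq (c %/ 2 ^ j) 2) modn2 addnC.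
  by rewrite expnSr divnMA.
by rewrite big_split /= -big_distrl /= addnAC addnC divnMDl.
Qed.

(** Legendre's formula for each factorial, padded to the common range up to [m]: the terms with
    [k > c] vanish because [c < p ^ k]. *)
Lemma logn_prod_fact (p m : nat) (cs : seq nat) :
  prime p -> all (leq^~ m) cs ->
  logn p (\prod_(c <- cs) c`!)
    = \sum_(1 <= k < m.+1) \sum_(c <- cs) c %/ p ^ k.
Proof.
move=> p_pr; rewrite exchange_big /=.
elim: cs => [_|c cs IHcs /= /andP[le_cm /IHcs IH]]; first by rewrite !big_nil logn1.
rewrite !big_cons lognM ?fact_gt0 ?prodn_gt0 // => [|i]; last exact: fact_gt0.
rewrite IH logn_fact //; congr (_ + _).
rewrite [RHS](@big_cat_nat _ _ _ c.+1) //= [X in _ = _ + X]big_nat_cond.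
rewrite [X in _ = _ + X]big1 ?addn0 // => k /andP[/andP[lt_ck _] _].
by rewrite divn_small // (ltn_trans lt_ck) // ltn_expl // prime_gt1.
Qed.

Lemma sumn_co (n : nat) (T : {set 'I_n}) : sumn (co T) = n.
Proof.
rewrite sumnE co_block big_map -[RHS](card_ord n) -[RHS]sum1_card.
have -> : iota 0 #|T|.+1 = index_iota 0 #|T|.+1 by rewrite /index_iota subn0.
rewrite big_mkord (partition_big (fun i : 'I_n => inord (block T i) : 'I_#|T|.+1) xpredT) //=.
apply: eq_bigr => k _; rewrite -sum1dep_card; apply: eq_bigl => i.
by rewrite -val_eqE /= inordK // ltnS block_max.
Qed.

(** Taking 2-adic valuations in [card_descent_sub] leaves the sum of the carries into columns 1 to
    [n] as the valuation of the count. *)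
Lemma odd_descent_sub (n : nat) (T : {set 'I_n}) :
  odd #|[set pi : 'S_n | descent_set pi \subset T]| = no_carry (co T).
Proof.
have cardT := card_descent_sub T; set a := #|_| in cardT *.
have a_gt0 : 0 < a by move: (fact_gt0 n); rewrite -cardT muln_gt0 => /andP[].
have co_le : all (leq^~ n) (co T).
  by apply/allP => c; rewrite co_block => /mapP[k _ ->]; rewrite -[leqRHS](card_ord n) max_card.
have := congr1 (logn 2) cardT.
rewrite lognM //; last by rewrite prodn_gt0 // => i; apply: fact_gt0.
rewrite logn_fact // (logn_prod_fact _ co_le) //.
rewrite [RHS](eq_bigr (fun k => \sum_(c <- co T) c %/ 2 ^ k + carry (co T) k));
  last by move=> k _; rewrite -divn_sum_carry sumn_co.
rewrite big_split /= addnC => /addnI log_a.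
have -> : odd a = (logn 2 a == 0).
  by rewrite lognE a_gt0 dvdn2 /=; case: (odd a).
rewrite log_a /no_carry sum_nat_seq_eq0.
(* [no_carry] also inspects column 0, whose incoming carry is 0 by definition. *)
apply/allP/forallP => [nc [[|j] lt_j] //|nc j].
  by apply: nc; rewrite mem_index_iota /= -[X in _ < X.+1](sumn_co T).
rewrite mem_index_iota => /andP[_ lt_j] /=; rewrite -[X in _ < X.+1](sumn_co T) in lt_j.
exact: (nc (Ordinal lt_j)).
Qed.

(** * Parity of the descent statistic and of the Euler characteristic *)

Lemma odd_sum (I : Type) (r : seq I) (P : pred I) (F : I -> nat) :
  odd (\sum_(i <- r | P i) F i) = \big[addb/false]_(i <- r | P i) odd (F i).
Proof. exact: (big_morph odd oddD erefl). Qed.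

(** If [A] lies in [B], adjoining [A] is a bijection from the subsets of [B :\: A], so the size is a
    power of two, equal to 1 only when that difference is empty. *)
Lemma odd_card_interval (T : finType) (A B : {set T}) :
  odd #|[set C : {set T} | (A \subset C) && (C \subset B)]| = (A == B).
Proof.
have [sAB|nsAB] := boolP (A \subset B); last first.
  rewrite (_ : [set _ | _] = set0) ?cards0.
    by apply/esym/eqP => AB; rewrite AB subxx in nsAB.
  apply/setP => C; rewrite !inE; apply/negP => /andP[sAC sCB].
  by rewrite (subset_trans sAC sCB) in nsAB.
have -> : [set C : {set T} | (A \subset C) && (C \subset B)]
        = (fun C => A :|: C) @: powerset (B :\: A).
  apply/setP => C; rewrite inE; apply/andP/imsetP => [[sAC sCB]|[D]].
    exists (C :\: A); first by rewrite inE setSD.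
    by rewrite -{1}(setID C A) (setIidPr sAC).
  rewrite inE subsetD => /andP[sDB _] ->.
  by rewrite subsetUl subUset sAB.
rewrite card_in_imset => [|C D].
  by rewrite card_powerset oddX orbF cards_eq0 setD_eq0 eqEsubset sAB.
rewrite !inE !subsetD => /andP[_ /setDidPl CA] /andP[_ /setDidPl DA] eqCD.
by rewrite -CA -DA -[C :\: A]set0U -[D :\: A]set0U -(setDv A) -!setDUl eqCD.
Qed.

(** Exchanging the sums, each [pi] is counted once for every [T] between its descent set and [S]: an
    interval, of odd size only when the two ends agree. *)
Lemma odd_beta (n : nat) (S : {set 'I_n}) :
  odd (beta S)
  = odd (\sum_(T : {set 'I_n} | T \subset S)
           #|[set pi : 'S_n | descent_set pi \subset T]|).
Proof.
under eq_bigr do rewrite -sum1dep_card big_mkcond /=.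
rewrite exchange_big /= /beta -sum1dep_card big_mkcond /= !odd_sum.
apply: eq_bigr => pi _.
rewrite -big_mkcondr sum1dep_card.
under eq_finset do rewrite andbC.
by rewrite odd_card_interval; case: eqP.
Qed.

Lemma reduced_euler_mod2 (n : nat) (K : {set {set 'I_n}}) :
  (reduced_euler K = #|K|%:Z %[mod 2])%Z.
Proof.
apply/eqP; rewrite eqz_mod_dvd -[X in (_ - X)%R]natz -sumr_const -sumrB.
(* Each difference is 0 or -2. For the empty face, with exponent -1, this is a computation;
   otherwise the exponent is a natural number. *)
apply: rpred_sum => F _; case: #|F| => [//|m].
rewrite (_ : m.+1%:Z - 1 = m)%R; last by lia.
by rewrite -exprnP -signr_odd; case: odd.
Qed.

Theorem theorem3p2 (n : nat) (n_gt0 : 0 < n) (S : {set 'I_n})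
    (S_sub : S \subset positions n) :
  ((beta S)%:Z = reduced_euler (induced (Delta n) S) %[mod 2])%Z.
Proof.
rewrite reduced_euler_mod2 !modz_nat !modn2; congr (Posz (nat_of_bool _)).
rewrite odd_beta odd_sum -sum1_card odd_sum big_mkcond [RHS]big_mkcond /=.
(* Both sides are now exclusive-or sums over all [T], compared term by term; those not inside [S]
   contribute [false]. *)
apply: eq_bigr => T _; rewrite odd_descent_sub !inE andbC.
have [sTS|//] := boolP (T \subset S).
by rewrite (subset_trans sTS S_sub); case: no_carry.
Qed.
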